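(* Given a probability distribution $P = p_1, \ldots, p_n$, we can construct a probability distribution $Q = q_1, \ldots, q_n$ with $\max_{1 \leq i \leq n} \{p_i / q_i\} < 4$, so $D(P \| Q) < 2$, and store $Q$ exactly in $2n - 2$ bits of space. Constructing, storing and recovering $Q$ each take $O(n)$ time.
   Context: A probability distribution $P = p_1, \ldots, p_n$ is simply a (finite, ordered) sequence of non-negative real numbers that sum to $1$; the sample space is not stored. $\log$ means $\log_2$. The relative entropy of $P$ with respect to $Q$ is $D(P \| Q) = \sum_{i=1}^n p_i \log \frac{p_i}{q_i}$ (terms with $p_i = 0$ contribute $0$). ''Storing $Q$ exactly in $m$ bits'' means that $Q$ is encoded by a binary string of $m$ bits from which (with $n$ known) the whole sequence $q_1, \ldots, q_n$ can be recovered exactly. Time is the number of elementary steps of the corresponding algorithm (constructing $Q$ from $P$, producing the binary string, and recovering $Q$ from the string). *)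

(* Defs.v *)
From mathcomp Require Import all_boot all_order all_algebra.
From mathcomp Require Import reals exp.

Set Implicit Arguments.
Unset Strict Implicit.
Unset Printing Implicit Defensive.

Import Order.TTheory GRing.Theory Num.Theory.
Local Open Scope ring_scope.

Definition distribution (R : realType) (n : nat) (P : n.-tuple R) : Prop :=
  (forall i, 0 <= tnth P i) /\ \sum_(i < n) tnth P i = 1.

Definition log2 (R : realType) (x : R) : R := ln x / ln 2.

(* The convention that terms with p_i = 0 contribute 0 holds because the
   factor [tnth P i] vanishes. Meaningful only when q_i > 0 wherever p_i > 0. *)
Definition relative_entropy (R : realType) (n : nat) (P Q : n.-tuple R) : R :=
  \sum_(i < n) tnth P i * log2 (tnth P i / tnth Q i).

(* The ratios are nonnegative, so the neutral element 0 does not affect the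
   maximum when n > 0. Meaningful only when every q_i is positive, since
   x / 0 = 0. *)
Definition max_ratio (R : realType) (n : nat) (P Q : n.-tuple R) : R :=
  \big[Num.max/0]_(i < n) (tnth P i / tnth Q i).

(* Time is measured on a real RAM with unit-cost instructions. A state consists
   of integer and real registers, and of integer, real and bit memories; memory
   is addressed by the contents of integer registers. Programs contain no real
   constants besides natural numbers, and there is no rounding instruction and
   no other conversion from reals to integers, so that a real number can only
   be inspected through comparisons. *)
Record state (R : Type) : Type := State {
  ireg : nat -> nat;
  rreg : nat -> R;
  imem : nat -> nat;
  rmem : nat -> R;
  bmem : nat -> bool }.

(* The first argument is the destination: a register, or for the three Store
   instructions the integer register holding the destination address. *)
Inductive instr : Type :=
| IConst of nat & nat
| IAdd of nat & nat & nat
| ISub of nat & nat & nat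
| ILoad of nat & nat
| IStore of nat & nat
| RConst of nat & nat
| RAdd of nat & nat & nat
| RSub of nat & nat & nat
| RMul of nat & nat & nat
| RDiv of nat & nat & nat
| RLoad of nat & nat
| RStore of nat & nat
| BLoad of nat & nat
| BStore of nat & nat.

(* Integer subtraction is truncated at 0, and real division by 0 yields 0. *)
Definition step (R : realType) (c : instr) (s : state R) : state R :=
  let: State gi gr mi mr mb := s in
  match c with
  | IConst d k => State [eta gi with d |-> k] gr mi mr mb
  | IAdd d a b => State [eta gi with d |-> (gi a + gi b)%N] gr mi mr mb
  | ISub d a b => State [eta gi with d |-> (gi a - gi b)%N] gr mi mr mb
  | ILoad d a  => State [eta gi with d |-> mi (gi a)] gr mi mr mb
  | IStore d a => State gi gr [eta mi with gi d |-> gi a] mr mb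
  | RConst d k => State gi [eta gr with d |-> k%:R] mi mr mb
  | RAdd d a b => State gi [eta gr with d |-> gr a + gr b] mi mr mb
  | RSub d a b => State gi [eta gr with d |-> gr a - gr b] mi mr mb
  | RMul d a b => State gi [eta gr with d |-> gr a * gr b] mi mr mb
  | RDiv d a b => State gi [eta gr with d |-> gr a / gr b] mi mr mb
  | RLoad d a  => State gi [eta gr with d |-> mr (gi a)] mi mr mb
  | RStore d a => State gi gr mi [eta mr with gi d |-> gr a] mb
  | BLoad d a  => State [eta gi with d |-> nat_of_bool (mb (gi a))] gr mi mr mb
  | BStore d a => State gi gr mi mr [eta mb with gi d |-> gi a != 0%N]
  end.

Inductive test : Type :=
| ILt of nat & nat
| ILe of nat & nat
| RLt of nat & nat
| RLe of nat & nat.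

Definition holds_test (R : realType) (b : test) (s : state R) : bool :=
  match b with
  | ILt x y => (ireg s x < ireg s y)%N
  | ILe x y => (ireg s x <= ireg s y)%N
  | RLt x y => rreg s x < rreg s y
  | RLe x y => rreg s x <= rreg s y
  end.

Inductive program : Type :=
| Skip
| Do of instr
| Seq of program & program
| If of test & program & program
| While of test & program.

(* [exec c s t s']: started in s, the program c halts in s' after exactly t
   elementary steps; each instruction and each evaluation of a test is one
   step. *)
Inductive exec (R : realType) :
  program -> state R -> nat -> state R -> Prop :=
| exec_skip s : exec Skip s 0 s
| exec_do c s : exec (Do c) s 1 (step c s)
| exec_seq c1 c2 s1 s2 s3 t1 t2 :
    exec c1 s1 t1 s2 -> exec c2 s2 t2 s3 ->
    exec (Seq c1 c2) s1 (t1 + t2) s3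
| exec_if b c1 c2 s t s' :
    exec (if holds_test b s then c1 else c2) s t s' ->
    exec (If b c1 c2) s t.+1 s'
| exec_while_done b c s :
    ~~ holds_test b s -> exec (While b c) s 1 s
| exec_while_loop b c s1 s2 s3 t1 t2 :
    holds_test b s1 -> exec c s1 t1 s2 -> exec (While b c) s2 t2 s3 ->
    exec (While b c) s1 (t1 + t2).+1 s3.

Definition halts_within (R : realType) (c : program) (s : state R) (T : nat)
    (s' : state R) : Prop :=
  exists2 t, (t <= T)%N & exec c s t s'.

(* In an initial state, n is in integer register 0, the input starts at address
   0 of the real or bit memory, and everything else is zero. Likewise, an
   output starts at address 0 of the real or bit memory of the final state. *)
Definition real_input (R : realType) (n : nat) (x : seq R) : state R :=
  State [eta (fun=> 0%N) with 0%N |-> n] (fun=> 0) (fun=> 0%N) (nth 0 x)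
    (fun=> false).

Definition bit_input (R : realType) (n : nat) (b : seq bool) : state R :=
  State [eta (fun=> 0%N) with 0%N |-> n] (fun=> 0) (fun=> 0%N) (fun=> 0)
    (nth false b).

Definition computes_reals (R : realType) (c : program) (s : state R) (T : nat)
    (y : seq R) : Prop :=
  exists2 s', halts_within c s T s' & mkseq (rmem s') (size y) = y.

Definition computes_bits (R : realType) (c : program) (s : state R) (T : nat)
    (y : seq bool) : Prop :=
  exists2 s', halts_within c s T s' & mkseq (bmem s') (size y) = y.

(* Main.v *)
Require Import Defs.
From mathcomp Require Import all_boot all_order all_algebra.
From mathcomp Require Import reals exp.
From mathcomp Require Import ring lra zify.

(** For n + 1 symbols, cut a grid of 2 n + 1 points into n + 1 consecutive
    nonempty segments, the i-th one having more than n p_i points, and let q_i be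
    the proportion of points in the i-th segment. This is possible because
    segments of 1 + floor (n (p_0 + ... + p_i)) - floor (n (p_0 + ... + p_(i-1)))
    points add up to (n + 1) + n. A segment of g points satisfies g >= 1 >= p_i
    and g > n p_i, so p_i / q_i < 4. The segments are recorded by marking their
    last points; the mark on the last grid point is redundant, which leaves 2 n
    bits. Each of the three algorithms is one pass over the grid that decides by
    a single comparison whether the current point is the last of its segment, so
    that no rounding is needed. *)

Set Implicit Arguments.
Unset Strict Implicit.
Unset Printing Implicit Defensive.

Import Order.TTheory GRing.Theory Num.Theory.
Local Open Scope ring_scope.

(** * Running programs *)

(** A total-correctness assertion with a time bound. [computes_reals] and [computes_bits] unfold to
    it, the postcondition being that the output can be read off the memory. *)
Definition terminates (R : realType) (c : program) (s : state R) (T : nat)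
    (post : state R -> Prop) : Prop :=
  exists2 s', halts_within c s T s' & post s'.

Lemma terminates_leq (R : realType) c (s : state R) T T' post :
  (T <= T')%N -> terminates c s T post -> terminates c s T' post.
Proof.
move=> leT [s' [t let_ Hc] Hs']; exists s' => //.
by exists t => //; apply: leq_trans leT.
Qed.

Lemma terminates_sub (R : realType) c (s : state R) T post post' :
  (forall s', post s' -> post' s') ->
  terminates c s T post -> terminates c s T post'.
Proof. by move=> sub [s' Hc Hs']; exists s' => //; apply: sub. Qed.

Lemma terminates_seq (R : realType) c1 c2 (s : state R) T1 T2 post :
  terminates c1 s T1 (fun s' => terminates c2 s' T2 post) ->
  terminates (Seq c1 c2) s (T1 + T2)%N post.
Proof.
move=> [s1 [t1 le1 H1] [s2 [t2 le2 H2] H]]; exists s2 => //.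
by exists (t1 + t2)%N; [apply: leq_add|apply: exec_seq H1 H2].
Qed.

Lemma terminates_if (R : realType) b c1 c2 (s : state R) T post :
  terminates (if holds_test b s then c1 else c2) s T post ->
  terminates (If b c1 c2) s T.+1 post.
Proof.
by move=> [s' [t let_ H] Hp]; exists s' => //; exists t.+1 => //; apply: exec_if.
Qed.

Lemma terminates_while (R : realType) (I : nat -> state R -> Prop) N K b c s :
  I 0%N s ->
  (forall m s, (m < N)%N -> I m s ->
     holds_test b s /\ terminates c s K (I m.+1)) ->
  (forall s, I N s -> ~~ holds_test b s) ->
  terminates (While b c) s (N * K.+1).+1 (I N).
Proof.
move=> I0 Iloop Iend.
(* Induction on the number [j] of rounds left. A round costs its body and one test; the final
   failing test gives the outer successor. *)
suff H j m s' : (j + m)%N = N -> I m s' ->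
    terminates (While b c) s' (j * K.+1).+1 (I N) by apply: H I0; rewrite addn0.
elim: j m s' => [|j IH] m s'.
  rewrite add0n => -> HI; exists s' => //.
  by exists 1%N => //; apply: exec_while_done; apply: Iend.
move=> jm HI; have ltm : (m < N)%N by lia.
have [Hb [s1 [t1 le1 H1] HI1]] := Iloop _ _ ltm HI.
have [|s2 [t2 le2 H2] HI2] := IH m.+1 s1 _ HI1; first by lia.
exists s2 => //; exists (t1 + t2).+1; last exact: exec_while_loop H1 H2.
by rewrite mulSn; lia.
Qed.

Definition block (cs : seq instr) : program := foldr (Seq \o Do) Skip cs.

Arguments block : simpl never.

Definition steps (R : realType) (cs : seq instr) (s : state R) : state R :=
  foldl (fun s c => step c s) s cs.

Lemma terminates_block (R : realType) cs (s : state R) post :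
  post (steps cs s) -> terminates (block cs) s (size cs) post.
Proof.
rewrite /block; elim: cs s => [|c cs IH] s /= H.
  by exists s => //; exists 0%N => //; apply: exec_skip.
have [s' [t let_ Ht] Hs'] := IH (step c s) H.
by exists s' => //; exists (1 + t)%N => //; apply: exec_seq Ht; apply: exec_do.
Qed.

(** * Scanning a grid that is cut into consecutive segments *)

(* Register allocation, for [n.+1] symbols, the i-th of which owns the grid
   points [e i <= m < e i.+1], where [e 0 = 0] and [e n.+1 = 2 * n + 1]:
   integer registers: 0: n + 1, 1: one, 2: 2 n + 1, 3: grid point m,
                      4: current symbol i, 5: scratch, 6: zero;
   real registers:    1: one, 2: 2 n + 1, 3: m + 1 - e i, 4: n, 5: scratch,
                      6: n (p_0 + ... + p_(i-1)) - (e i - i) in [construct],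
                         which is the fractional part of the first term. *)

(** No instruction moves an integer into a real register, so the real [n + 1] is obtained by
    counting. *)
Definition setup : program :=
  Seq (block [:: IConst 1 1; RConst 1 1])
  (Seq (While (ILt 3 0) (block [:: RAdd 2 2 1; IAdd 3 3 1]))
       (block [:: IAdd 2 0 0; ISub 2 2 1; RSub 4 2 1; RAdd 2 2 4;
                  IConst 3 0; RConst 3 1])).

(** [emit] runs before the counters advance, so it finds the full segment length in real register
    3. *)
Definition scan (probe : seq instr) (t : test) (emit : seq instr) : program :=
  While (ILt 3 2)
    (Seq (block probe)
         (If t (block (emit ++ [:: IAdd 4 4 1; RConst 3 1; IAdd 3 3 1]))
               (block [:: RAdd 3 3 1; IAdd 3 3 1]))).

Definition scanning (R : realType) (e : nat -> nat) (n i m : nat) (s : state R)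
    : Prop :=
  [/\ ireg s 1 = 1%N, ireg s 2 = (2 * n).+1, ireg s 3 = m, ireg s 4 = i &
      ireg s 6 = 0%N] /\
  [/\ rreg s 1 = 1, rreg s 2 = (2 * n).+1%:R,
      rreg s 3 = m.+1%:R - (e i)%:R & rreg s 4 = n%:R].

Lemma setup_correct (R : realType) (e : nat -> nat) n (mr : nat -> R) mb :
  e 0%N = 0%N ->
  terminates setup
    (State [eta (fun=> 0%N) with 0%N |-> n.+1] (fun=> 0) (fun=> 0%N) mr mb)
    (3 * n + 12)%N
    (fun s => [/\ scanning e n 0 0 s, rreg s 6 = 0, rmem s = mr & bmem s = mb]).
Proof.
move=> e0.
pose I m (s : state R) :=
  [/\ ireg s 0 = n.+1, ireg s 1 = 1%N, ireg s 3 = m, ireg s 4 = 0%N &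
      ireg s 6 = 0%N] /\
  [/\ rreg s 1 = 1, rreg s 2 = m%:R, rreg s 6 = 0, rmem s = mr & bmem s = mb].
apply: (@terminates_leq _ _ _ (2 + ((n.+1 * 3).+1 + 6))); first by lia.
apply: terminates_seq; apply: terminates_block => /=.
apply: terminates_seq; apply: (@terminates_sub _ _ _ _ (I n.+1)).
  case=> gi gr mi mr' mb' [/= [H0 H1 H3 H4 H6] [G1 G2 G6 -> ->]].
  apply: terminates_block => /=; split=> //; split=> /=; split=> //.
  - by rewrite H0 H1; lia.
  - by rewrite G1 G2 -!natr1 natrM; ring.
  - by rewrite e0 subr0.
  - by rewrite G1 G2 -natr1 addrK.
apply: terminates_while => //= [m [gi gr mi mr' mb'] ltm|[gi gr mi mr' mb']].
- move=> [/= [H0 H1 H3 H4 H6] [G1 G2 G6 Gr Gb]]; split; first by rewrite H0 H3.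
  apply: terminates_block; split=> /=; split=> //; first by rewrite H3 H1 addn1.
  by rewrite G1 G2 natr1.
- by move=> [/= [-> _ -> _ _] _]; rewrite ltnn.
Qed.

Lemma leq_mono_step (e : nat -> nat) :
  (forall i, (e i < e i.+1)%N) -> {mono e : i j / (i <= j)%N}.
Proof.
by move=> e_lt; apply: leq_mono; apply: homo_ltn e_lt; apply: ltn_trans.
Qed.

(** The loop invariant is [inv] together with the fact that [i] is the segment of point [m]. The
    body hypothesis stops short of the counter updates, which all three programs share. *)
Lemma scan_correct (R : realType) (e : nat -> nat) n probe t emit
    (inv : nat -> nat -> R -> (nat -> R) -> (nat -> bool) -> Prop) s :
  e 0%N = 0%N -> (forall i, (e i < e i.+1)%N) -> e n.+1 = (2 * n).+1 ->
  (forall i m s, (i <= n)%N -> (e i <= m < e i.+1)%N ->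
     scanning e n i m s -> inv i m (rreg s 6) (rmem s) (bmem s) ->
     let stop := m.+1 == e i.+1 in
     let s1 := steps probe s in
     let s2 := if stop then steps emit s1 else s1 in
     [/\ holds_test t s1 = stop, scanning e n i m s2 &
         inv (i + stop)%N m.+1 (rreg s2 6) (rmem s2) (bmem s2)]) ->
  scanning e n 0 0 s -> inv 0%N 0%N (rreg s 6) (rmem s) (bmem s) ->
  terminates (scan probe t emit) s
    ((2 * n).+1 * (size probe + size emit + 6)).+1
    (fun s' => inv n.+1 (2 * n).+1 (rreg s' 6) (rmem s') (bmem s')).
Proof.
move=> e0 e_lt en Hbody Hs Hinv.
have e_mono := leqW_mono (leq_mono_step e_lt).
pose I m (s : state R) := exists i,
  [/\ (i <= n.+1)%N, (e i <= m)%N, (i <= n)%N -> (m < e i.+1)%N,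
      scanning e n i m s & inv i m (rreg s 6) (rmem s) (bmem s)].
apply: (@terminates_sub _ _ _ _ (I (2 * n).+1)).
  (* At the exit [m = e n.+1], so [m < e i.+1] excludes [i <= n]. *)
  move=> s' [i [lein _ lei _ Hi]]; case: (ltngtP i n.+1) lein => // [ltin _|<- //].
  have := lei ltin; rewrite -en; case: (ltngtP i.+1 n.+1) ltin => // [|-> _].
    by rewrite -e_mono; lia.
  by rewrite ltnn.
rewrite (_ : size probe + size emit + 6 = (size probe + (size emit + 4).+1).+1)%N;
  last by lia.
apply: terminates_while.
- by exists 0%N; split=> //; rewrite ?e0 // => _; rewrite -[X in (X < _)%N]e0.
- move=> m s' ltm [i [lein lei lti Hsc Hi]].
  have {}lein : (i <= n)%N.
    by move: lein; rewrite leq_eqVlt => /orP[/eqP ii|//]; move: lei; rewrite ii en; lia.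
  have {}lti := lti lein.
  have [|Ht Hsc2 Hi2] := Hbody i m s' lein _ Hsc Hi; first by rewrite lei.
  split; first by move: Hsc => [[_ H2 H3 _ _] _] /=; rewrite H2 H3.
  apply: terminates_seq; apply: terminates_block; apply: terminates_if.
  move: Ht Hsc2 Hi2; case: eqP => [em -> Hsc2 Hi2|em -> Hsc2 Hi2].
    apply: (@terminates_leq _ _ _
      (size (emit ++ [:: IAdd 4 4 1; RConst 3 1; IAdd 3 3 1]))).
      by rewrite size_cat /=; lia.
    apply: terminates_block; exists i.+1; rewrite /steps foldl_cat -/(steps _ _).
    rewrite -/(steps emit (steps probe s')) in Hsc2 Hi2 *.
    case: (steps emit _) Hsc2 Hi2 => gi gr mi mr mb
      [/= [H1 H2 H3 H4 H6] [G1 G2 G3 G4]] Hi2.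
    split=> //=; first by rewrite em.
    + by move=> _; rewrite em.
    + split=> /=; split=> //; rewrite ?H1 ?H3 ?H4 ?addn1 //.
      by rewrite em -[in RHS]natr1 addrAC subrr add0r.
    + by move: Hi2; rewrite addn1.
  apply: (@terminates_leq _ _ _ 2); first by lia.
  apply: terminates_block; exists i => /=.
  case: (steps probe s') Hsc2 Hi2 => gi gr mi mr mb
    [/= [H1 H2 H3 H4 H6] [G1 G2 G3 G4]] Hi2.
  split=> //=; [by lia|by lia|by lia| |].
  - split=> /=; split=> //; rewrite ?H1 ?H3 ?H4 ?addn1 //.
    by rewrite G1 G3 -[in RHS]natr1 addrAC.
  - by move: Hi2; rewrite addn0.
- move=> s' [i [_ _ _ [[_ H2 H3 _ _] _] _]] /=.
  by rewrite H2 H3 ltnn.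
Qed.

(** * The three programs *)

(** [q_i * (2 n + 1)] is the length of segment [i], which the count of its points reaches exactly at
    the last one. Integer register 2 is nonzero, so [BStore 3 2] writes a mark. *)
Definition store : program :=
  Seq setup (scan [:: RLoad 5 4; RMul 5 5 2] (RLe 5 3) [:: BStore 3 2]).

(* The mark on the last grid point is not part of the input and is written
   before the scan. *)
Definition recover : program :=
  Seq setup (Seq (block [:: ISub 5 2 1; BStore 5 1])
    (scan [:: BLoad 5 3] (ILt 6 5) [:: RDiv 5 3 2; RStore 4 5])).

(** With [S] the sum of [p_0, ..., p_i], real register 5 holds [n S - (e i - i)], and the test
    amounts to [n S < m + 1 - i]. [emit] updates the fractional part and overwrites [p_i] with
    [q_i]. *)
Definition construct : program :=
  Seq setup
    (scan [:: RLoad 5 4; RMul 5 5 4; RAdd 5 5 6] (RLt 5 3)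
       [:: RSub 6 5 3; RAdd 6 6 1; RDiv 5 3 2; RStore 4 5]).

Definition is_end (e : nat -> nat) (n m : nat) : bool :=
  [exists i : 'I_n.+1, m.+1 == e i.+1].

(** If [e j.+1 = m.+1], then [e i < e j.+1 <= e i.+1], and monotonicity forces [j = i]. *)
Lemma is_endE (e : nat -> nat) n i m :
  (forall i, (e i < e i.+1)%N) -> (i <= n)%N -> (e i <= m < e i.+1)%N ->
  is_end e n m = (m.+1 == e i.+1).
Proof.
move=> e_lt lein /andP[lei lti]; apply/existsP/eqP => [[j /eqP mj]|mi]; last first.
  by exists (Ordinal (lein : (i < n.+1)%N)); rewrite mi.
have e_mono := leqW_mono (leq_mono_step e_lt).
have : (e i < e j.+1)%N by rewrite -mj ltnS.
have : ~~ (e i.+1 < e j.+1)%N by rewrite -mj ltnS -ltnNge.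
by rewrite !e_mono mj => ? ?; congr e; lia.
Qed.

Lemma store_correct (R : realType) (e : nat -> nat) n (x : nat -> R) :
  e 0%N = 0%N -> (forall i, (e i < e i.+1)%N) -> e n.+1 = (2 * n).+1 ->
  (forall i, (i <= n)%N -> x i * (2 * n).+1%:R = (e i.+1)%:R - (e i)%:R) ->
  terminates store
    (State [eta (fun=> 0%N) with 0%N |-> n.+1] (fun=> 0) (fun=> 0%N) x
       (fun=> false))
    (50 * n.+1)%N
    (fun s => forall k, (k < (2 * n).+1)%N -> bmem s k = is_end e n k).
Proof.
move=> e0 e_lt en xE.
apply: (@terminates_leq _ _ _ (3 * n + 12 + ((2 * n).+1 * (2 + 1 + 6)).+1));
  first by lia.
apply: terminates_seq; apply: terminates_sub (setup_correct _ _ _ e0).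
move=> s [Hs _ Hr Hb].
(* Points not yet scanned keep the initial value [false]. *)
pose inv (_ m : nat) (_ : R) (r : nat -> R) (b : nat -> bool) :=
  r = x /\ forall k, b k = (k < m)%N && is_end e n k.
apply: (@terminates_sub _ _ _ _
  (fun s => inv n.+1 (2 * n).+1 (rreg s 6) (rmem s) (bmem s))).
  by move=> s' [_ Hb'] k ltk; rewrite Hb' ltk.
apply: (@scan_correct _ e) => //; last by split=> // k; rewrite Hb.
case: s {Hs Hr Hb} => _ _ _ _ _ i m [gi gr mi mr mb] lein lem
  [/= [H1 H2 H3 H4 H6] [G1 G2 G3 G4]] [/= -> Hb].
have endE := is_endE e_lt lein lem.
split.
- rewrite H4 G2 xE // G3 lerD2r ler_nat; apply/idP/eqP; move: lem; lia.
- by case: ifP.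
- case: ifP => em /=; split=> //= k.
  + rewrite H2 H3; case: eqP => [->|nk]; first by rewrite ltnSn endE em.
    by rewrite Hb ltnS [in RHS]leq_eqVlt; case: eqP nk.
  + rewrite Hb ltnS [in RHS]leq_eqVlt; case: eqP => //= ->.
    by rewrite ltnn endE em.
Qed.

(** The input is constrained only below address [2 * n]; the mark closing the last segment is
    supplied by the program. *)
Lemma recover_correct (R : realType) (e : nat -> nat) n (b : nat -> bool) :
  e 0%N = 0%N -> (forall i, (e i < e i.+1)%N) -> e n.+1 = (2 * n).+1 ->
  (forall k, (k < 2 * n)%N -> b k = is_end e n k) ->
  terminates recover
    (State [eta (fun=> 0%N) with 0%N |-> n.+1] (fun=> 0) (fun=> 0%N) (fun=> 0) b)
    (50 * n.+1)%N
    (fun s : state R => forall i, (i <= n)%N ->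
       rmem s i = ((e i.+1)%:R - (e i)%:R) / (2 * n).+1%:R).
Proof.
move=> e0 e_lt en bE.
apply: (@terminates_leq _ _ _ (3 * n + 12 + (2 + ((2 * n).+1 * (1 + 2 + 6)).+1)));
  first by lia.
apply: terminates_seq; apply: terminates_sub (setup_correct _ _ _ e0).
move=> s [Hs _ Hr Hb]; apply: terminates_seq; apply: terminates_block.
pose inv (i _ : nat) (_ : R) (r : nat -> R) (b : nat -> bool) :=
  (forall k, (k < (2 * n).+1)%N -> b k = is_end e n k) /\
  forall j, (j < i)%N -> r j = ((e j.+1)%:R - (e j)%:R) / (2 * n).+1%:R.
apply: (@terminates_sub _ _ _ _
  (fun s => inv n.+1 (2 * n).+1 (rreg s 6) (rmem s) (bmem s))).
  by move=> s' [_ Hr'] k lek; apply: Hr'.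
have last_end : is_end e n (2 * n).
  by apply/existsP; exists ord_max; rewrite en.
apply: (@scan_correct _ e) => //.
- case: s {Hs Hr Hb} => _ _ _ _ _ i m [gi gr mi mr mb] lein lem
    [/= [H1 H2 H3 H4 H6] [G1 G2 G3 G4]] [/= Hb Hr].
  have endE := is_endE e_lt lein lem.
  have ltm : (m < (2 * n).+1)%N.
    by case/andP: lem => _ /leq_trans; apply; rewrite -en (leq_mono_step e_lt).
  split.
  + by rewrite H3 H6 Hb // endE lt0b.
  + by case: ifP.
  + case: ifP => em /=; rewrite ?addn0 ?addn1; split=> //= j.
    rewrite H4 ltnS leq_eqVlt G2 G3 (eqP em).
    by case: eqP => [-> _|_ /=]; last exact: Hr.
- by case: s Hs {Hr Hb} => gi gr mi mr mb.
- case: s Hs Hr Hb => gi gr mi mr mb [/= [H1 H2 _ _ _] _] _ ->.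
  split=> //= k; rewrite H1 H2 subn1 ltnS leq_eqVlt /=.
  by case: eqP => [-> _|_ /=]; [rewrite last_end|apply: bE].
Qed.

(** * The distribution *)

(** Rounding partial sums instead of single terms keeps the total exact; the summand [i] gives each
    segment a point of its own. *)
Definition cut (R : realType) (n : nat) (p : nat -> R) (i : nat) : nat :=
  (i + Num.truncn (n%:R * \sum_(0 <= j < i) p j))%N.

Lemma cut_ge0 (R : realType) (n : nat) (p : nat -> R) i :
  (forall j, 0 <= p j) -> 0 <= n%:R * \sum_(0 <= j < i) p j.
Proof. by move=> p0; rewrite mulr_ge0 // sumr_ge0. Qed.

Lemma cut_itv (R : realType) (n : nat) (p : nat -> R) i :
  (forall j, 0 <= p j) ->
  (cut n p i)%:R - i%:R <= n%:R * \sum_(0 <= j < i) p j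
    < (cut n p i)%:R - i%:R + 1.
Proof.
move=> p0; have := truncn_itv (cut_ge0 n i p0).
by rewrite /cut natrD -natr1 addrAC subrr add0r.
Qed.

Lemma cut0 (R : realType) (n : nat) (p : nat -> R) : cut n p 0 = 0%N.
Proof. by rewrite /cut big_geq // mulr0 truncn0. Qed.

Lemma cut_lt (R : realType) (n : nat) (p : nat -> R) i :
  (forall j, 0 <= p j) -> (cut n p i < cut n p i.+1)%N.
Proof.
move=> p0; rewrite /cut addSn ltnS leq_add2l; apply: le_truncn.
by rewrite big_nat_recr //= ler_wpM2l // lerDl.
Qed.

Lemma cut_last (R : realType) (n : nat) (p : nat -> R) :
  \sum_(0 <= j < n.+1) p j = 1 -> cut n p n.+1 = (2 * n).+1.
Proof. by move=> sum1; rewrite /cut sum1 mulr1 natrK; lia. Qed.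

(** Subtract the lower bound of [cut_itv] at [i] from its strict upper bound at [i.+1]; the extra
    point of the segment absorbs the rounding error. *)
Lemma cut_gap (R : realType) (n : nat) (p : nat -> R) i :
  (forall j, 0 <= p j) ->
  n%:R * p i < (cut n p i.+1)%:R - (cut n p i)%:R.
Proof.
move=> p0; have /andP[lo _] := cut_itv n i p0.
have /andP[_] := cut_itv n i.+1 p0.
by rewrite big_nat_recr //= mulrDr -[i.+1%:R]natr1; lra.
Qed.

Lemma construct_correct (R : realType) n (p : nat -> R) :
  (forall j, 0 <= p j) -> \sum_(0 <= j < n.+1) p j = 1 ->
  terminates construct
    (State [eta (fun=> 0%N) with 0%N |-> n.+1] (fun=> 0) (fun=> 0%N) p
       (fun=> false))
    (50 * n.+1)%N
    (fun s => forall i, (i <= n)%N ->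
       rmem s i = ((cut n p i.+1)%:R - (cut n p i)%:R) / (2 * n).+1%:R).
Proof.
move=> p0 sum1; set e := cut n p.
apply: (@terminates_leq _ _ _ (3 * n + 12 + ((2 * n).+1 * (3 + 4 + 6)).+1));
  first by lia.
apply: terminates_seq; apply: terminates_sub (setup_correct _ _ _ (cut0 n p)).
move=> s [Hs Hw Hr Hb].
(* The output replaces the input in place: [q] below [i], still [p] from [i] on. *)
pose inv (i _ : nat) (w : R) (r : nat -> R) (_ : nat -> bool) :=
  [/\ w = n%:R * (\sum_(0 <= j < i) p j) - ((e i)%:R - i%:R),
      forall j, (i <= j)%N -> r j = p j &
      forall j, (j < i)%N -> r j = ((e j.+1)%:R - (e j)%:R) / (2 * n).+1%:R].
apply: (@terminates_sub _ _ _ _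
  (fun s => inv n.+1 (2 * n).+1 (rreg s 6) (rmem s) (bmem s))).
  by move=> s' [_ _ Hr'] k lek; apply: Hr'.
apply: (@scan_correct _ e) => //; [exact: cut0|by move=> i; apply: cut_lt|
  exact: cut_last| |]; last first.
  by split=> [|j _|//]; rewrite ?Hr // Hw /e cut0 big_geq // mulr0 !subr0.
case: s {Hs Hw Hr Hb} => _ _ _ _ _ i m [gi gr mi mr mb] lein lem
  [/= [H1 H2 H3 H4 H6] [G1 G2 G3 G4]] [/= Gw Hp Hq].
have x5 : p i * n%:R + gr 6 =
    n%:R * (\sum_(0 <= j < i.+1) p j) - ((e i)%:R - i%:R).
  by rewrite Gw big_nat_recr //=; ring.
have itv := cut_itv n i.+1 p0.
rewrite H4 Hp // G4 x5 G3 G2 G1; split.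
- have -> : n%:R * (\sum_(0 <= j < i.+1) p j) - ((e i)%:R - i%:R)
     < m.+1%:R - (e i)%:R = (n%:R * (\sum_(0 <= j < i.+1) p j) < m.+1%:R - i%:R :> R).
    by apply/idP/idP; lra.
  apply/idP/eqP => [lt|->]; last first.
    by move: itv; rewrite -/e -[i.+1%:R]natr1; lra.
  (* The floor bound turns the successful test into [e i.+1 <= m.+1]; [m < e i.+1] gives the
     converse. *)
  have : (e i.+1)%:R < (m.+2)%:R :> R.
    by move: itv; rewrite -/e -[i.+1%:R]natr1 -[m.+2%:R]natr1; lra.
  by rewrite ltr_nat; move: lem; lia.
- by case: ifP.
- case: ifP => em /=; rewrite ?addn0 ?addn1; last by split.
  split=> [|j ltj|j] /=.
  + by rewrite (eqP em) -[i.+1%:R]natr1; ring.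
  + by rewrite Hp ?(ltnW ltj) // gtn_eqF.
  + rewrite ltnS leq_eqVlt (eqP em).
    by case: eqP => [-> _|_ /=]; last exact: Hq.
Qed.

(** The relative entropy is the [P]-average of the logarithms of the ratios, each below [c] where
    [P] is positive. Some entry is positive, which makes the inequality strict. *)
Lemma relative_entropy_lt (R : realType) n (P Q : n.-tuple R) (c : R) :
  distribution P -> (forall i, 0 < tnth Q i) ->
  (forall i, tnth P i / tnth Q i < 2 `^ c) -> relative_entropy P Q < c.
Proof.
move=> [P0 P1] Q0 ltc.
have [i Pi] : exists i, 0 < tnth P i.
  apply/existsP; apply: contraT => /existsPn Pn; move: P1; rewrite big1.
    by move/eqP; rewrite eq_sym oner_eq0.
  by move=> i _; apply/eqP; rewrite eq_le P0 andbT leNgt Pn.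
have ln2 : 0 < ln 2 :> R by rewrite ln_gt0 ?ltr1n.
have term j : 0 < tnth P j -> tnth P j * log2 (tnth P j / tnth Q j) < tnth P j * c.
  move=> Pj; rewrite ltr_pM2l // /log2 ltr_pdivrMr // -ln_powR.
  by rewrite ltr_ln ?posrE ?divr_gt0 // ?powR_gt0.
have -> : c = \sum_(j < n) tnth P j * c by rewrite -mulr_suml P1 mul1r.
rewrite /relative_entropy (bigD1 i) //= [ltRHS](bigD1 i) //=.
apply: ltr_leD; first exact: term.
apply: ler_sum => j _; have := P0 j; rewrite le_eqVlt => /orP[/eqP <-|/term/ltW //].
by rewrite !mul0r.
Qed.

Theorem theorem2 (R : realType) :
  exists (construct store recover : program) (C : nat),
    forall (n : nat) (P : n.-tuple R), distribution P ->
      exists (Q : n.-tuple R) (b : (2 * n - 2)%N.-tuple bool),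
        [/\ distribution Q,
            forall i, 0 < tnth Q i,
            max_ratio P Q < 4 &
            relative_entropy P Q < 2] /\
        [/\ computes_reals construct (real_input n P) (C * n)%N Q,
            computes_bits store (real_input n Q) (C * n)%N b &
            computes_reals recover (bit_input R n b) (C * n)%N Q].
Proof.
(* For [n + 1] symbols each of the three running times is at most [29 n + 26]. *)
exists construct, store, recover, 50%N => -[|n] P distP.
  by case: distP => _; rewrite big_ord0 => /eqP; rewrite eq_sym oner_eq0.
have [P0 P1] := distP.
(* The default 0 makes [p] nonnegative at every index, as the lemmas on [cut] require. *)
pose p j := nth 0 P j.
have tnthP (i : 'I_n.+1) : tnth P i = p i by rewrite (tnth_nth 0).
have p0 j : 0 <= p j.
  have [ltj|lej] := ltnP j n.+1; first by rewrite -(tnthP (Ordinal ltj)).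
  by rewrite /p nth_default // size_tuple.
have p1 : \sum_(0 <= j < n.+1) p j = 1.
  by rewrite big_mkord -P1; apply: eq_bigr => i _.
have ple1 (i : 'I_n.+1) : p i <= 1.
  by rewrite -P1 (bigD1 i) //= tnthP lerDl sumr_ge0.
set e := cut n p.
have e0 : e 0%N = 0%N := cut0 n p.
have e_lt i : (e i < e i.+1)%N := cut_lt n i p0.
have en : e n.+1 = (2 * n).+1 := cut_last p1.
pose q i : R := ((e i.+1)%:R - (e i)%:R) / (2 * n).+1%:R.
have D0 : 0 < (2 * n).+1%:R :> R by rewrite ltr0n.
pose Q := [tuple q i | i < n.+1].
have tnthQ (i : 'I_n.+1) : tnth Q i = q i by rewrite tnth_mktuple.
have Q0 i : 0 < tnth Q i by rewrite tnthQ divr_gt0 // subr_gt0 ltr_nat.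
have ratio i : tnth P i / tnth Q i < 4.
  (* For a segment of [g] points, [2 n p_i < 2 g] and [p_i <= 1 <= g] give [(2 n + 1) p_i < 3 g]. *)
  rewrite ltr_pdivrMr // tnthQ tnthP /q mulrA ltr_pdivlMr //.
  have gap : n%:R * p i < (e i.+1)%:R - (e i)%:R := cut_gap n i p0.
  have gap1 : (e i)%:R + 1 <= (e i.+1)%:R :> R by rewrite natr1 ler_nat.
  have := ple1 i; rewrite -[(2 * n).+1%:R]natr1 natrM; lra.
have nthQ k : (k < n.+1)%N -> nth 0 Q k = q k.
  by move=> ltk; rewrite -(tnthQ (Ordinal ltk)) (tnth_nth 0).
pose b := [tuple is_end e n k | k < 2 * n.+1 - 2].
have szb : (2 * n.+1 - 2 = 2 * n)%N by lia.
have nthb k : (k < 2 * n)%N -> nth false b k = is_end e n k.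
  rewrite -szb => ltk.
  have := tnth_mktuple (fun k : 'I_(2 * n.+1 - 2) => is_end e n k) (Ordinal ltk).
  by rewrite (tnth_nth false).
have readQ (s : state R) : (forall i, (i <= n)%N -> rmem s i = q i) ->
    mkseq (rmem s) (size Q) = Q.
  move=> rs; apply: (@eq_from_nth _ 0); rewrite size_mkseq // size_tuple => i lti.
  by rewrite nth_mkseq // rs // nthQ.
exists Q, b; split; split=> //.
- split=> [i|]; first exact: ltW.
  under eq_bigr do rewrite tnthQ; rewrite -mulr_suml.
  rewrite -(big_mkord xpredT (fun i => (e i.+1)%:R - (e i)%:R)).
  by rewrite telescope_sumr // en e0 subr0 divff // gt_eqF.
- by apply: bigmax_lt => // i _; apply: ratio.
- apply: relative_entropy_lt => // i.
  (* The ratio bound 4 is 2 to the power [c = 2]. *)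
  by rewrite -[2]/(2%:R) powR_mulrn // -natrX.
- exact: terminates_sub readQ (construct_correct p0 p1).
- apply: terminates_sub (store_correct e0 e_lt en _) => [s bs|i lei].
    apply: (@eq_from_nth _ false); rewrite size_mkseq // size_tuple => k ltk.
    by rewrite nth_mkseq // nthb -?szb // bs // ltnS -szb ltnW.
  by rewrite nthQ // divfK // gt_eqF.
- exact: terminates_sub readQ (recover_correct R e0 e_lt en nthb).
Qed.
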